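(* Let $m\ge0$ be an integer and $t$ a positive odd integer not divisible by $3$; put $m_0=m$, $t_0=t$, and let $0\le i_0\le m_0$ with $n_{i_0}(m_0,t_0)>1$. Then there exists a unique (finite or infinite) series of Collatz's Sequences $$S_c(s)=\{S_c(m_j,t_j)\mid j=0,1,2,\dots,s-1\},\qquad s\in\{1,2,\dots\}\cup\{\infty\},$$ such that for each $j$ with $0\le j\le s-1$ (all $j\ge 0$ if $s=\infty$), $0\le i_j\le m_j$, $n_{i_j}(m_j,t_j)$ is odd and greater than $1$, and $$n_{m_j+1}(m_j,t_j)=2^{r_{j+1}}n_{i_{j+1}}(m_{j+1},t_{j+1}),\qquad r_{j+1}\ge1,\quad 0\le i_{j+1}\le m_{j+1},$$ with $n_{i_{j+1}}(m_{j+1},t_{j+1})$ odd, and such that $n_{i_s}(m_s,t_s)=1$ if $s$ is finite.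
   Context: For an integer $m\ge 0$ and a positive odd integer $t$ not divisible by $3$, the Collatz's Sequence $S_c(m,t)$ consists of $n_i(m,t)=2^{m+1-i}3^it-1$, $0\le i\le m+1$; then $n_{i+1}(m,t)=(3n_i(m,t)+1)/2$ for $0\le i\le m$, $n_0(m,t),\dots,n_m(m,t)$ are odd and $n_{m+1}(m,t)$ is even. Every positive odd integer $n$ can be written as $n_i(m',t')$ with $m'\ge0$, $0\le i\le m'$ and $t'$ positive, odd and not divisible by $3$ (via $n+1=2^{m'+1-i}3^it'$). *)

(* Defs.v *)
From mathcomp Require Import all_boot.

Set Implicit Arguments.
Unset Strict Implicit.
Unset Printing Implicit Defensive.

Definition collatz_param (t : nat) : bool := [&& 0 < t, odd t & ~~ (3 %| t)].

(* n_i(m,t), for i <= m + 1 and 0 < t: in this range neither of the two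
   natural-number subtractions is truncated. *)
Definition collatz_term (i m t : nat) : nat := 2 ^ (m + 1 - i) * 3 ^ i * t - 1.

(* S_c(m,t) as the list n_0(m,t), ..., n_(m+1)(m,t). For 0 < t it determines
   m (its size is m + 2) and t (its head is 2 ^ (m + 1) * t - 1). *)
Definition collatz_seq (m t : nat) : seq nat :=
  [seq collatz_term i m t | i <- iota 0 m.+2].

(* A length s in {1, 2, ...} or infinity is an [option nat], with [None]
   standing for infinity. *)
Definition before (j : nat) (s : option nat) : bool :=
  if s is Some k then j < k else true.

(* The series of length s whose j-th member is S j; the values S j with
   j >= s are irrelevant. When s = Some k, the parameters m, t, i are used at
   the indices 0, ..., k, but S_c(m_k, t_k) is not a member of the series. *)
Definition collatz_series (m0 t0 i0 : nat) (s : option nat)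
    (S : nat -> seq nat) : Prop :=
  s <> Some 0 /\
  exists m t i r : nat -> nat,
  [/\ [/\ m 0 = m0, t 0 = t0 & i 0 = i0],
      forall j, before j s ->
        [/\ collatz_param (t j),
            S j = collatz_seq (m j) (t j),
            i j <= m j,
            odd (collatz_term (i j) (m j) (t j))
          & 1 < collatz_term (i j) (m j) (t j)],
      forall j, before j s ->
        [/\ collatz_param (t j.+1),
            collatz_term (m j).+1 (m j) (t j) =
              2 ^ r j.+1 * collatz_term (i j.+1) (m j.+1) (t j.+1),
            1 <= r j.+1,
            i j.+1 <= m j.+1
          & odd (collatz_term (i j.+1) (m j.+1) (t j.+1))]
    & forall k, s = Some k -> collatz_term (i k) (m k) (t k) = 1].

(* Main.v *)
Require Import Defs.
From mathcomp Require Import all_boot.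
From Stdlib Require Import Classical.

(** Since n + 1 = 2 ^ (m + 1 - i) * 3 ^ i * t with t prime to 6, an odd n
    determines its position (m, t, i), and the even last term of S_c(m, t)
    determines its odd part. So the n_(i_j)(m_j, t_j) of a series can only be
    the iterates of a map [next_odd], and the length can only be the first index
    at which they reach 1, or infinity. *)

Definition term_index (n : nat) : nat := logn 3 n.+1.
(** In n + 1 = 2 ^ (m + 1 - i) * 3 ^ i * t the two valuations add up to m + 1, hence the
    predecessor; for odd n it is not truncated. *)
Definition term_m (n : nat) : nat := (logn 2 n.+1 + logn 3 n.+1).-1.
Definition term_t (n : nat) : nat := (n.+1`_(2^'))`_(3^').
Definition last_term (n : nat) : nat :=
  collatz_term (term_m n).+1 (term_m n) (term_t n).
Definition next_odd (n : nat) : nat := (last_term n)`_(2^').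

Lemma collatz_termS {i m t : nat} (ht : collatz_param t) :
  (collatz_term i m t).+1 = 2 ^ (m + 1 - i) * (3 ^ i * t).
Proof.
have /and3P[t0 _ _] := ht.
by rewrite /collatz_term subn1 prednK ?mulnA // !muln_gt0 !expn_gt0.
Qed.

Lemma two'_exp3M {i t : nat} (ht : collatz_param t) : 2^'.-nat (3 ^ i * t).
Proof. by have /and3P[_ ot _] := ht; rewrite -odd_2'nat oddM oddX ot orbT. Qed.

Lemma three'_param {t : nat} (ht : collatz_param t) : 3^'.-nat t.
Proof. by have /and3P[t0 _ nt] := ht; rewrite p'natE. Qed.

Lemma odd_collatz_term {i m t : nat} (ht : collatz_param t) :
  i <= m -> odd (collatz_term i m t).
Proof.
move=> im; have := congr1 odd (@collatz_termS i m t ht).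
by rewrite oddM oddX subn_eq0 addn1 leqNgt ltnS im /= => /negbFE.
Qed.

(** Uniqueness of the position: as t is prime to 6, the valuations of the successor at 2 and 3 are
    exactly m + 1 - i and i, and t is what remains. *)
Lemma decode_collatz_term {i m t : nat} (ht : collatz_param t) (im : i <= m) :
  [/\ term_index (collatz_term i m t) = i, term_m (collatz_term i m t) = m
    & term_t (collatz_term i m t) = t].
Proof.
have /and3P[t0 ot nt] := ht.
have p0 : 0 < 3 ^ i * t by rewrite muln_gt0 expn_gt0.
have L3 : logn 3 (2 ^ (m + 1 - i) * (3 ^ i * t)) = i.
  rewrite lognM ?expn_gt0 // lognX (lognM _ (expn_gt0 3 i)) // pfactorK //.
  by rewrite muln0 (lognE 3 t) (negPf nt) !andbF addn0.
have L2 : logn 2 (2 ^ (m + 1 - i) * (3 ^ i * t)) = m + 1 - i.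
  rewrite lognM ?expn_gt0 // pfactorK // (lognE 2 (3 ^ i * t)) dvdn2.
  by rewrite oddM oddX ot orbT !andbF addn0.
rewrite /term_index /term_m /term_t (collatz_termS ht) L3 L2; split=> //.
  by rewrite subnK ?addn1 // leqW.
rewrite partnM ?expn_gt0 // (part_pnat_id (two'_exp3M ht)).
rewrite (part_p'nat (n := 2 ^ _)) ?pnatNK ?pnatX ?pnat_id // mul1n.
rewrite partnM ?expn_gt0 // (part_pnat_id (three'_param ht)).
by rewrite part_p'nat ?mul1n ?pnatNK ?pnatX ?pnat_id.
Qed.

(** Existence of the position: n + 1 is even, so its 2-adic valuation m + 1 - i is positive, which
    is the bound i <= m. *)
Lemma term_decomposition {n : nat} (on : odd n) :
  [/\ collatz_param (term_t n), term_index n <= term_m n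
    & collatz_term (term_index n) (term_m n) (term_t n) = n].
Proof.
have l2 : 0 < logn 2 n.+1 by rewrite logn_gt0 mem_primes dvdn2 /= on.
(* [term_t] removes the factors 2 and 3 in turn; removing the 2-part first leaves the 3-part
   intact. *)
have E : n.+1`_(2^')`_3 = 3 ^ logn 3 n.+1.
  by rewrite partn_part ?p_part // => p; rewrite !inE => /eqP ->.
have idm : term_m n + 1 - term_index n = logn 2 n.+1.
  by rewrite /term_m addn1 prednK ?addn_gt0 ?l2 // addnK.
split.
- apply/and3P; split; first exact: part_gt0.
    rewrite odd_2'nat; apply: pnat_dvd (part_pnat (2^') n.+1).
    exact: dvdn_part.
  by rewrite -p'natE ?part_pnat // part_gt0.
- rewrite /term_m /term_index -ltnS prednK ?addn_gt0 ?l2 //.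
  by rewrite -[X in X < _]add0n ltn_add2r.
rewrite /collatz_term idm /term_index -E -[2 ^ _]p_part -mulnA.
by rewrite /term_t partnC ?part_gt0 // partnC // subn1.
Qed.

(** The successor of the last term is 3 ^ (m + 1) * t, which is at least 3. Positivity allows the
    last term to be split into its 2-part and its odd part. *)
Lemma last_term_gt0 {n : nat} (on : odd n) : 0 < last_term n.
Proof.
have [ht _ _] := term_decomposition on; have /and3P[t0 _ _] := ht.
rewrite -ltnS /last_term (collatz_termS ht) addn1 subnn mul1n.
rewrite (leq_trans _ (leq_pmulr _ t0)) //.
by rewrite expnS (leq_trans _ (leq_pmulr _ _)) ?expn_gt0.
Qed.

(** The successor 3 ^ (m + 1) * t is odd; this is what gives r >= 1 in a series. *)
Lemma odd_last_term {n : nat} (on : odd n) : odd (last_term n) = false.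
Proof.
have [ht _ _] := term_decomposition on.
have := congr1 odd (@collatz_termS (term_m n).+1 (term_m n) _ ht).
by rewrite addn1 subnn mul1n (odd_2'nat (3 ^ _ * _)) two'_exp3M //= => /negbTE.
Qed.

Lemma last_termE {n : nat} (on : odd n) :
  last_term n = 2 ^ logn 2 (last_term n) * next_odd n.
Proof. by rewrite -p_part partnC // last_term_gt0. Qed.

Lemma next_unique {n r x : nat} :
  odd x -> last_term n = 2 ^ r * x -> x = next_odd n.
Proof.
move=> ox; rewrite /next_odd => ->; rewrite partnM ?expn_gt0 ?(odd_gt0 ox) //.
rewrite (part_pnat_id (n := x)) -?odd_2'nat //.
by rewrite (part_p'nat (n := 2 ^ r)) ?mul1n ?pnatNK ?pnatX ?pnat_id.
Qed.

Lemma odd_iter_next {n : nat} (j : nat) : odd n -> odd (iter j next_odd n).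
Proof. by case: j => // j _; rewrite iterS odd_2'nat part_pnat. Qed.

Definition orbit_seq (n j : nat) : seq nat :=
  collatz_seq (term_m (iter j next_odd n)) (term_t (iter j next_odd n)).

Definition orbit_length (n : nat) (s : option nat) : Prop :=
  (forall j, before j s -> 1 < iter j next_odd n) /\
  (forall k, s = Some k -> iter k next_odd n = 1).

(** Whether 1 is reached is the Collatz problem itself, so excluded middle separates the two cases;
    in the finite one, minimality of the index keeps all earlier iterates above 1. *)
Lemma orbit_length_exists {n : nat} (on : odd n) : exists s, orbit_length n s.
Proof.
have gt1 j : iter j next_odd n != 1 -> 1 < iter j next_odd n.
  by move=> ne1; rewrite ltn_neqAle eq_sym ne1 odd_gt0 ?odd_iter_next.
have [ex1|no1] := classic (exists j, iter j next_odd n == 1).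
  case: (ex_minnP ex1) => k /eqP xk kmin.
  exists (Some k); split=> [j /= jk|_ [<-] //].
  by apply: gt1; apply/negP => /kmin; rewrite leqNgt jk.
exists None; split=> // j _; apply: gt1; apply/negP => xj.
by apply: no1; exists j.
Qed.

(** A finite length k puts the value 1 at index k, whereas any length beyond k would require a value
    above 1 there; so neither length can exceed the other. *)
Lemma orbit_length_unique {n : nat} {s s' : option nat} :
  orbit_length n s -> orbit_length n s' -> s' = s.
Proof.
have stop k u : orbit_length n (Some k) -> orbit_length n u -> ~~ before k u.
  move=> [_ /(_ _ erefl) xk] [gt1 _].
  by apply/negP => /gt1; rewrite xk.
case: s s' => [k|] [k'|] // hs hs'; first last.
- by have := stop _ _ hs' hs.
- by have := stop _ _ hs hs'.
have := stop _ _ hs' hs; have := stop _ _ hs hs'; rewrite /= -!leqNgt => le ge.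
by congr Some; apply/eqP; rewrite eqn_leq le ge.
Qed.

Lemma orbit_series {m t i0 : nat} {s : option nat} (ht : collatz_param t)
    (hi0 : i0 <= m) (hn : 1 < collatz_term i0 m t) :
  orbit_length (collatz_term i0 m t) s ->
  collatz_series m t i0 s (orbit_seq (collatz_term i0 m t)).
Proof.
set n := collatz_term i0 m t => -[gt1 eq1].
have on : odd n by exact: odd_collatz_term.
have ox j := @odd_iter_next n j on.
split=> [s0|]; first by move: hn; rewrite -/n (eq1 0 s0 : n = 1).
have [Di Dm Dt] := decode_collatz_term ht hi0.
(* The exponent [r j.+1] belongs to the last term of the j-th sequence, hence the shift by
   [j.-1]. *)
exists (fun j => term_m (iter j next_odd n)),
  (fun j => term_t (iter j next_odd n)),
  (fun j => term_index (iter j next_odd n)),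
  (fun j => logn 2 (last_term (iter j.-1 next_odd n))).
split=> // [j js|j js|k sk].
- have [tj ij ->] := term_decomposition (ox j).
  by split=> //; apply: gt1.
- have [tj ij ->] := term_decomposition (ox j.+1).
  split=> //; first exact: last_termE.
  by rewrite /= logn_gt0 mem_primes last_term_gt0 // dvdn2 odd_last_term.
have [_ _ ->] := term_decomposition (ox k); exact: eq1.
Qed.

(** Induction along the series: decoding the j-th term identifies the last term of its sequence,
    whose odd part is the only possible next term. *)
Lemma series_orbit {m t i0 : nat} {s : option nat} {S : nat -> seq nat}
    (ht : collatz_param t) (hi0 : i0 <= m) :
  collatz_series m t i0 s S ->
  orbit_length (collatz_term i0 m t) s /\
  forall j, before j s -> S j = orbit_seq (collatz_term i0 m t) j.
Proof.
move=> [s0 [m_ [t_ [i_ [r [[m0 t0 i_0] mem step stop]]]]]].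
set n := collatz_term i0 m t.
have beforeW j : before j.+1 s -> before j s.
  by case: (s) => //= k /ltnW.
have xE j : before j s -> collatz_term (i_ j) (m_ j) (t_ j) = iter j next_odd n.
  elim: j => [|j IH] js; first by rewrite m0 t0 i_0.
  have [tj _ ij _ _] := mem _ (beforeW _ js).
  have [_ Dm Dt] := decode_collatz_term tj ij.
  have [_ lastE _ _ oj] := step _ (beforeW _ js).
  rewrite iterS -(IH (beforeW _ js)); apply: (next_unique (r := r j.+1)) => //.
  by rewrite /last_term Dm Dt.
split; first split=> [j js|k sk].
- by rewrite -xE //; have [] := mem _ js.
(* The final index k is not before [Some k], so [xE] stops just short of it; as k is nonzero, one
   more step from its predecessor reaches it. *)
- case: k sk => [/s0 //|k] sk; have ks : before k s by rewrite sk /=.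
  have [tk _ ik _ _] := mem _ ks.
  have [_ Dm Dt] := decode_collatz_term tk ik.
  have [_ lastE _ _ ok] := step _ ks.
  rewrite iterS -xE // -(stop _ sk).
  by apply/esym/(next_unique (r := r k.+1)) => //; rewrite /last_term Dm Dt.
move=> j js; have [tj -> ij _ _] := mem _ js.
have [_ Dm Dt] := decode_collatz_term tj ij.
by rewrite /orbit_seq -xE // Dm Dt.
Qed.

Theorem lemma3p17 (m t i0 : nat) (ht : collatz_param t) (hi0 : i0 <= m)
    (hn : 1 < collatz_term i0 m t) :
  exists (s : option nat) (S : nat -> seq nat),
    collatz_series m t i0 s S /\
    (forall (s' : option nat) (S' : nat -> seq nat),
        collatz_series m t i0 s' S' ->
        s' = s /\ (forall j : nat, before j s -> S' j = S j)).
Proof.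
have [s len_s] := orbit_length_exists (odd_collatz_term ht hi0).
exists s, (orbit_seq (collatz_term i0 m t)).
split=> [|s' S' /(series_orbit ht hi0)[len_s' S'E]]; first exact: orbit_series.
by have ss' := orbit_length_unique len_s len_s'; subst s'.
Qed.
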